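(* Let $r\in\mathbb N$. Then there exist an integer $k=k(r)$ and formulas $\varphi_+(z,\bar x)$, $\varphi_-(z,\bar x)$, $\varphi_\sim(z_1,z_2,\bar x)$ of flip-reachability logic, with $|\bar x|=k$, such that: (1) for every undirected graph $G$ and every $\bar a\in V(G)^k$, the formulas $\varphi_+,\varphi_-,\varphi_\sim$ with $\bar a$ define an $\bar a$-uniform seed of $G$; and (2) for every undirected graph $G$, \[\mathrm{LowRank}^r(G)=\bigcup_{\bar a\in V(G)^k}\mathrm{Span}(\mathrm{Seed}(\varphi_+,\varphi_-,\varphi_\sim,\bar a)).\]
   Context: Graphs are finite, simple, undirected, vertex-colored with a fixed finite set of unary predicates. $\mathrm{rk}(X)$ is the rank over $\mathbb F_2$ of the adjacency matrix between $X$ and $V(G)\setminus X$, and $\mathrm{LowRank}^r(G)=\{X\subseteq V(G):\mathrm{rk}(X)\le r\}$. Atomic type $\mathrm{atp}(v_1,\dots,v_k)$: set of atomic formulas $x_i=x_j$, $E(x_i,x_j)$, $U(x_i)$ satisfied; $\mathrm{atp}^k$: all atomic types of $k$-tuples. For $A\subseteq\mathrm{atp}^{k+1}\times\mathrm{atp}^{k+1}$ and $\bar a\in V(G)^k$, $G\oplus_{\bar a}A$ is the digraph on $V(G)$ with arc $\vec{uv}$ ($u\neq v$) iff $[uv\in E(G)]$ xor $[(\mathrm{atp}(u,\bar a),\mathrm{atp}(v,\bar a))\in A]$. Flip-reachability logic: first-order logic over graphs extended by predicates $\mathrm{flipreach}_{k,A}(s,t,\bar a)$ holding iff there is a directed path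 from $s$ to $t$ in $G\oplus_{\bar a}A$. A seed of $G$ is a triple $(X_+,X_-,\mathcal X)$ with $X_+,X_-\subseteq V(G)$, $\mathcal X$ a collection of nonempty subsets of $V(G)$, such that $\mathcal X\cup\{X_+,X_-\}$ is a partition of $V(G)$ (with $X_+,X_-$ possibly empty). Its span is $\mathrm{Span}(X_+,X_-,\mathcal X)=\{X_+\cup\bigcup\mathcal Y:\mathcal Y\subseteq\mathcal X\}$. For $u\in\bigcup\mathcal X$ let $\mathcal X(u)$ be the part of $\mathcal X$ containing $u$. The seed is $\bar a$-uniform if for all $u_1,u_2\in\bigcup\mathcal X$ with $\mathrm{atp}(u_1,\bar a)=\mathrm{atp}(u_2,\bar a)$ we have $N(u_1)\setminus(\mathcal X(u_1)\cup\mathcal X(u_2))=N(u_2)\setminus(\mathcal X(u_1)\cup\mathcal X(u_2))$. Formulas $\varphi_+,\varphi_-,\varphi_\sim$ and a tuple $\bar a$ define a seed $(X_+,X_-,\mathcal X)$ if $X_+=\{v: G\models\varphi_+(v,\bar a)\}$, $X_-=\{v: G\models\varphi_-(v,\bar a)\}$, and two vertices $u,v\in V(G)\setminus(X_+\cup X_-)$ lie in the same part of $\mathcal X$ iff $G\models\varphi_\sim(u,v,\bar a)$; this seed, when it exists, is unique and denoted $\mathrm{Seed}(\varphi_+,\varphi_-,\varphi_\sim,\bar a)$. *)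

(* Defs.v *)
From HB Require Import structures.
From mathcomp Require Import all_boot all_algebra.

Set Implicit Arguments.
Unset Strict Implicit.
Unset Printing Implicit Defensive.

(* The finite set of unary predicate symbols is the parameter U. *)
Record cgraph (U : finType) := CGraph {
  vert :> finType;
  adj : rel vert;
  col : U -> pred vert;
  adj_sym : symmetric adj;
  adj_irr : irreflexive adj }.

Inductive atom (U : finType) (k : nat) : Type :=
| AEq of 'I_k & 'I_k
| AAdj of 'I_k & 'I_k
| ACol of U & 'I_k.

Section AtomFinType.
Variables (U : finType) (k : nat).

Definition atom_code (t : atom U k) : 'I_k * 'I_k + 'I_k * 'I_k + U * 'I_k :=
  match t with
  | AEq i j => inl (inl (i, j))
  | AAdj i j => inl (inr (i, j))
  | ACol c i => inr (c, i)
  end.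

Definition atom_decode (s : 'I_k * 'I_k + 'I_k * 'I_k + U * 'I_k) : atom U k :=
  match s with
  | inl (inl (i, j)) => AEq U i j
  | inl (inr (i, j)) => AAdj U i j
  | inr (c, i) => ACol c i
  end.

Lemma atom_codeK : cancel atom_code atom_decode.
Proof. by case. Qed.

HB.instance Definition _ := Finite.copy (atom U k) (can_type atom_codeK).

End AtomFinType.

(* All sets of atomic formulas, including those satisfied by no tuple of no
   graph: a relation on types only ever acts through the types of actual
   tuples, so the extra elements are immaterial. *)
Definition atype (U : finType) (k : nat) := {set atom U k}.

Definition atom_holds (U : finType) (G : cgraph U) k (v : k.-tuple G)
    (t : atom U k) : bool :=
  match t with
  | AEq i j => tnth v i == tnth v j
  | AAdj i j => adj (tnth v i) (tnth v j)
  | ACol c i => col c (tnth v i)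
  end.

Definition atp (U : finType) (G : cgraph U) k (v : k.-tuple G) : atype U k :=
  [set t | atom_holds v t].

Definition flip_arc (U : finType) (G : cgraph U) k
    (A : {set atype U k.+1 * atype U k.+1}) (a : k.-tuple G) : rel G :=
  fun u v =>
    (u != v) && (adj u v (+) ((atp [tuple of u :: a], atp [tuple of v :: a]) \in A)).

(* Well-scoped de Bruijn syntax: [frl U n] is the type of formulas of
   flip-reachability logic with free variables indexed by 'I_n.  A quantifier
   binds index 0 of its body and shifts the other variables by one. *)
Inductive frl (U : finType) : nat -> Type :=
| FEq n of 'I_n & 'I_n : frl U n
| FAdj n of 'I_n & 'I_n : frl U n
| FCol n of U & 'I_n : frl U n
| FReach n k (A : {set atype U k.+1 * atype U k.+1}) (s t : 'I_n)
    (a : k.-tuple 'I_n) : frl U n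
| FNot n of frl U n : frl U n
| FAnd n of frl U n & frl U n : frl U n
| FOr n of frl U n & frl U n : frl U n
| FEx n of frl U n.+1 : frl U n
| FAll n of frl U n.+1 : frl U n.

Fixpoint holds (U : finType) (G : cgraph U) n (phi : frl U n) :
    n.-tuple G -> bool :=
  match phi in frl _ n return n.-tuple G -> bool with
  | FEq _ i j => fun v => tnth v i == tnth v j
  | FAdj _ i j => fun v => adj (tnth v i) (tnth v j)
  | FCol _ c i => fun v => col c (tnth v i)
  | FReach _ _ A s t a => fun v =>
      connect (flip_arc A (map_tuple (tnth v) a)) (tnth v s) (tnth v t)
  | FNot _ p => fun v => ~~ holds p v
  | FAnd _ p q => fun v => holds p v && holds q v
  | FOr _ p q => fun v => holds p v || holds q v
  | FEx _ p => fun v => [exists x : G, holds p [tuple of x :: v]]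
  | FAll _ p => fun v => [forall x : G, holds p [tuple of x :: v]]
  end.

Definition nbh (U : finType) (G : cgraph U) (u : G) : {set G} :=
  [set v | adj u v].

Definition cutrk (U : finType) (G : cgraph U) (X : {set G}) : nat :=
  \rank (\matrix_(i < #|X|, j < #|~: X|)
           (adj (enum_val i) (enum_val j))%:R : 'M['F_2]_(#|X|, #|~: X|))%R.

Definition LowRank (U : finType) (r : nat) (G : cgraph U) : {set {set G}} :=
  [set X | cutrk X <= r].

Record triple (U : finType) (G : cgraph U) := Triple {
  plus : {set G};
  minus : {set G};
  parts : {set {set G}} }.

(* "parts together with plus and minus partition the vertices" is read for the
   indexed family: as a set of sets, a nonempty plus could coincide with minus
   or with one of the parts. *)
Definition is_seed (U : finType) (G : cgraph U) (S : triple G) : bool :=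
  [disjoint plus S & minus S] &&
  partition (parts S) (~: (plus S :|: minus S)).

Definition Span (U : finType) (G : cgraph U) (S : triple G) : {set {set G}} :=
  [set plus S :|: cover Y | Y in powerset (parts S)].

Definition uniform (U : finType) (G : cgraph U) k (a : k.-tuple G)
    (S : triple G) : Prop :=
  forall u1 u2 : G, u1 \in cover (parts S) -> u2 \in cover (parts S) ->
    atp [tuple of u1 :: a] = atp [tuple of u2 :: a] ->
    nbh u1 :\: (pblock (parts S) u1 :|: pblock (parts S) u2) =
    nbh u2 :\: (pblock (parts S) u1 :|: pblock (parts S) u2).

(* Free variables of fp and fm: z is index 0, followed by the k parameters;
   those of fs: z1, z2 are indices 0, 1, followed by the k parameters. *)
Definition defines_seed (U : finType) (G : cgraph U) k
    (fp fm : frl U k.+1) (fs : frl U k.+2) (a : k.-tuple G)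
    (S : triple G) : Prop :=
  [/\ is_seed S,
      plus S = [set v | holds fp [tuple of v :: a]],
      minus S = [set v | holds fm [tuple of v :: a]]
    & forall u v : G,
        u \notin plus S :|: minus S -> v \notin plus S :|: minus S ->
        (exists2 P, P \in parts S & (u \in P) && (v \in P)) <->
        holds fs [tuple of u :: [tuple of v :: a]]].

(* The only candidate for the seed defined by the formulas
   (see [defines_seed_uniq]); meaningless if they do not define a seed. *)
Definition Seed (U : finType) (G : cgraph U) k
    (fp fm : frl U k.+1) (fs : frl U k.+2) (a : k.-tuple G) : triple G :=
  let Xp := [set v | holds fp [tuple of v :: a]] in
  let Xm := [set v | holds fm [tuple of v :: a]] in
  Triple Xp Xm
    (equivalence_partition
       (fun u v => holds fs [tuple of u :: [tuple of v :: a]])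
       (~: (Xp :|: Xm))).

Lemma defines_seed_uniq (U : finType) (G : cgraph U) k
    (fp fm : frl U k.+1) (fs : frl U k.+2) (a : k.-tuple G) (S : triple G) :
  defines_seed fp fm fs a S -> S = Seed fp fm fs a.
Proof.
case: S => Xp Xm P [/= /andP[/= _ partP] defp defm sameP].
rewrite /Seed -defp -defm; congr Triple.
set D := ~: (Xp :|: Xm) in partP *.
have [/eqP covP trivP n0P] := and3P partP.
have PE x y : x \in D -> y \in D ->
    (y \in pblock P x) = holds fs [tuple of x :: [tuple of y :: a]].
  move=> Dx Dy; have xP : x \in cover P by rewrite covP.
  have Nx : x \notin Xp :|: Xm by rewrite -in_setC.
  have Ny : y \notin Xp :|: Xm by rewrite -in_setC.
  apply/idP/idP => [yPx | /(sameP _ _ Nx Ny)[B BP /andP[xB yB]]].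
    apply/(sameP _ _ Nx Ny); exists (pblock P x); first exact: pblock_mem.
    by rewrite mem_pblock xP.
  by rewrite (def_pblock trivP BP xB).
rewrite -[LHS](equivalence_partition_pblock partP).
apply: eq_in_imset => x Dx; apply/setP=> y; rewrite !in_set -!in_setU -in_setC.
by apply: andb_id2l => Dy; rewrite PE.
Qed.

(* Main.v *)
(** A set [X] of cut-rank at most [r] has rows [a] and columns [b] spanning its
cut matrix, so that for [u] in [X] and [v] outside,
[adj u v = form u v := adj(u,b) M^+ adj(a,v)], where [M] is the [a * b]
submatrix and [M^+] a pseudo-inverse.  In the digraph [D] obtained by flipping
[G] along [form], [X] is closed under out-arcs; conversely any set closed under
out-arcs of [D] has cut-rank at most [r], whatever [a] and [b] are.

It remains to cover the out-closed sets by boundedly many parameters.  Colour a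
vertex by its adjacency to [a] and [b].  Between two colours, [form] is either
symmetric, and then so are the arcs of [D], or not, and then any two vertices
of these two colours are joined by an arc, as in a tournament.  For each asymmetric pair of colours
we pick a vertex [p] of [X] reaching all vertices of [X] of one of the two
colours, and dually a vertex [q] outside [X].  Among the vertices neither
reachable from some [p] nor reaching some [q], an asymmetric pair of colours
that still occurs has one colour entirely inside [X] and the other entirely
outside; the former colours, marked by representatives [d], are added to the
positive part.  The rest then has only symmetric arcs, so its strongly
connected components are the parts of a seed having [X] in its span.  Parameters
violating the symmetry get the seed with the single part [V(G)], whose span
[{set0, V(G)}] also serves the two trivial sets. *)

From HB Require Import structures.
Require Import Defs.
From mathcomp Require Import all_boot all_algebra.

Set Implicit Arguments.
Unset Strict Implicit.
Unset Printing Implicit Defensive.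

(** * Cut-rank and factorisation through a pseudo-inverse *)

Lemma rowsub_pad (F : fieldType) m n r (C : 'M[F]_(m, n)) :
  'I_m -> \rank C <= r -> exists g : 'I_r -> 'I_m, (C <= rowsub g C)%MS.
Proof.
move=> x0 rk_r.
(* Exactly [r] rows are wanted whatever the rank, so indices past the rank repeat the row [x0]. *)
pose g (j : 'I_r) :=
  if insub (val j) is Some j' then maxrankfun C j' else x0.
exists g; rewrite -{1}(eq_maxrowsub C); apply/row_subP=> i.
have gE : g (widen_ord rk_r i) = maxrankfun C i.
  by rewrite /g; case: insubP => [j _ /val_inj -> | /negP[]] //=.
have -> : row i (rowsub (maxrankfun C) C) =
          row (widen_ord rk_r i) (rowsub g C).
  by apply/rowP=> j; rewrite !mxE gE.
exact: row_sub.
Qed.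

Lemma eq_F2 (b : bool) (x : 'F_2) : (b == (x == 1%R)) = ((b%:R)%R == x).
Proof. by move: x; case: b; do 2?case=> //; case=> [|[|[]]]. Qed.

Lemma mulmx3E (F : fieldType) m n p q (A : 'M[F]_(m, n)) (Q : 'M_(n, p))
    (B : 'M_(p, q)) i j :
  ((A *m Q *m B) i j = (row i A *m Q *m col j B) ord0 ord0)%R.
Proof.
by rewrite -row_mul mxE [RHS]mxE; apply: eq_bigr => l _; rewrite [in RHS]mxE
   [col _ _ _ _]mxE.
Qed.

Section CutForm.

Variables (U : finType) (G : cgraph U) (r : nat).

Definition cut_form (a b : 'I_r -> G) (u v : G) : 'F_2 :=
  ((\row_j (adj u (b j))%:R *m pinvmx (\matrix_(i, j) (adj (a i) (b j))%:R)
     *m \col_i (adj (a i) v)%:R) 0 0)%R.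

(** The form is the product of a factor in [u] with [r] columns and a factor in [v] with [r] rows,
    which bounds the rank. *)
Lemma cutrk_cut_form (X : {set G}) (a b : 'I_r -> G) :
  (forall u v, u \in X -> v \notin X -> ((adj u v)%:R)%R = cut_form a b u v) ->
  cutrk X <= r.
Proof.
move=> XE; rewrite /cutrk.
set C := (X in \rank X).
have -> : C = ((\matrix_(i < #|X|, j < r) (adj (enum_val i) (b j))%:R) *m
   (pinvmx (\matrix_(i, j) (adj (a i) (b j))%:R) *m
     (\matrix_(i < r, j < #|~: X|) (adj (a i) (enum_val j))%:R)))%R.
  apply/matrixP=> i j; rewrite mulmxA mulmx3E mxE XE ?enum_valP //; last first.
    by rewrite -in_setC enum_valP.
  congr ((_ *m _ *m _)%R _ _); apply/matrixP=> i' j'; by rewrite !mxE.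
by apply: leq_trans (mxrankM_maxl _ _) (rank_leq_col _).
Qed.

Lemma cut_form_exists (X : {set G}) (x0 y0 : G) :
  x0 \in X -> y0 \notin X -> cutrk X <= r ->
  exists a b : 'I_r -> G,
  forall u v, u \in X -> v \notin X -> ((adj u v)%:R)%R = cut_form a b u v.
Proof.
rewrite -in_setC => x0X y0X; rewrite /cutrk.
set C := (X in \rank X) => rkC.
have i0 := enum_rank_in x0X x0; have j0 := enum_rank_in y0X y0.
have [g gC] := rowsub_pad i0 rkC.
have rkCT : \rank (C^T)%R <= r by rewrite mxrank_tr.
have [h hC] := rowsub_pad j0 rkCT.
have [P CP] := submxP gC; have [R' CR'] := submxP hC.
pose R := (R'^T)%R; pose M : 'M_r := rowsub g (colsub h C).
have CR : C = (colsub h C *m R)%R.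
  rewrite -[LHS]trmxK CR' trmx_mul; congr (_ *m _)%R.
  by apply/matrixP=> i j; rewrite !mxE.
have aE : rowsub g C = (M *m R)%R by rewrite {1}CR -mul_rowsub_mx.
have bM : (colsub h C <= M)%MS.
  apply/submxP; exists P; rewrite {1}CP.
  by apply/matrixP=> i j; rewrite !mxE; apply: eq_bigr => l _; rewrite !mxE.
(* The rows of [colsub h C] lie in the row space of [M], so multiplying it by [pinvmx M *m M]
   changes nothing; what remains is [colsub h C *m R], that is, [C]. *)
have CE : C = (colsub h C *m pinvmx M *m rowsub g C)%R.
  by rewrite aE mulmxA mulmxKpV.
exists (fun j => enum_val (g j)), (fun j => enum_val (h j)) => u v uX.
rewrite -in_setC => vX.
have := congr1 (fun D : 'M_(_, _) => D (enum_rank_in uX u) (enum_rank_in vX v)) CE.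
rewrite {1}/C mxE !enum_rankK_in // mulmx3E /cut_form => ->.
set P1 := row _ _; set Q1 := col _ _.
set P2 := (\row_j _)%R; set M2 := (\matrix_(i, j) _)%R; set Q2 := (\col_i _)%R.
have <- : P1 = P2 by apply/rowP=> j; rewrite !mxE enum_rankK_in.
have <- : M = M2 by apply/matrixP=> i j; rewrite !mxE.
by have <- : Q1 = Q2 by apply/colP=> j; rewrite !mxE enum_rankK_in.
Qed.

End CutForm.

(** * Out-closed sets in digraphs with tournament-like pairs of colours *)

Section Tournament.

Variables (T K : finType) (c : T -> K) (asym : rel K).

(* A vertex [p] of colour [s] or [t] with a largest reachable set is reached
   back from everything it reaches; being comparable to all vertices of the
   other colour, it reaches them all. *)
Lemma dominating_vertex (e : rel T) (X : {set T}) (x0 : T) (s t : K) :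
  (forall u v, asym (c u) (c v) -> e u v || e v u) ->
  (forall k l, asym k l -> asym l k) ->
  x0 \in X -> asym s t ->
  exists2 p, p \in X & forall u v, u \in X -> v \in X -> c u = s -> c v = t ->
    connect e p u || connect e p v.
Proof.
move=> tour asymC x0X st.
pose Z u := (u \in X) && ((c u == s) || (c u == t)).
have [z Zz | noZ] := pickP Z; last first.
  by exists x0 => // u v uX _ us; have := noZ u; rewrite /Z uX us eqxx.
have [p /andP[pX pst] pmax] :=
  @arg_maxnP T z Z (fun u => #|[set v | connect e u v]|) Zz.
have reach_p v : Z v -> asym (c p) (c v) -> connect e p v.
  move=> Zv /tour/orP[|vp]; first exact: connect1.
  have sub : [set w | connect e p w] \subset [set w | connect e v w].
    apply/subsetP=> w; rewrite !inE; exact: connect_trans (connect1 vp).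
  have /eqP eqpv : [set w | connect e p w] == [set w | connect e v w].
    by rewrite eqEcard sub; exact: pmax.
  have : v \in [set w | connect e v w] by rewrite inE.
  by rewrite -eqpv inE.
exists p => // u v uX vX us vt; case/orP: pst => /eqP pc.
  by apply/orP; right; apply: reach_p; rewrite ?/Z ?vX ?pc vt ?eqxx ?orbT.
apply/orP; left; apply: reach_p; first by rewrite /Z uX us eqxx.
by rewrite pc us asymC.
Qed.

Definition coreach (e : rel T) (J : finType) (q : J -> T) : {set T} :=
  [set u | [exists j, connect e u (q j)]].

(* A representative lying in [coreach e q] is inactive: this encodes the set of
   colours to be added, which may be empty. *)
Definition source (e : rel T) (J J' : finType) (q p : J -> T) (d : J' -> T)
    (w : T) : bool :=
  (w \notin coreach e q) &&
  ([exists j, w == p j] ||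
   [exists i, (d i \notin coreach e q) && (c w == c (d i))]).

Definition reach (e : rel T) (J J' : finType) (q p : J -> T) (d : J' -> T) :
    {set T} :=
  [set u | [exists w, source e q p d w && connect e w u]].

Lemma coreach_closed (e : rel T) (J : finType) (q : J -> T) u v :
  connect e u v -> v \in coreach e q -> u \in coreach e q.
Proof.
move=> uv; rewrite !inE => /existsP[j vj]; apply/existsP; exists j.
exact: connect_trans vj.
Qed.

Lemma reach_closed (e : rel T) (J J' : finType) (q p : J -> T) (d : J' -> T)
    u v : connect e u v -> u \in reach e q p d -> v \in reach e q p d.
Proof.
move=> uv; rewrite !inE => /existsP[w /andP[sw wu]]; apply/existsP; exists w.
by rewrite sw (connect_trans wu).
Qed.

Lemma reach_coreach (e : rel T) (J J' : finType) (q p : J -> T) (d : J' -> T) :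
  [disjoint reach e q p d & coreach e q].
Proof.
rewrite disjoints_subset; apply/subsetP=> u; rewrite inE => /existsP[w].
case/andP=> /andP[wq _] wu; rewrite in_setC; apply: contra wq.
exact: coreach_closed.
Qed.

Lemma out_closed_connect (e : rel T) (X : {set T}) u v :
  (forall x y, x \in X -> e x y -> y \in X) ->
  u \in X -> connect e u v -> v \in X.
Proof.
move=> clX uX /connectP[s es ->]; elim: s u uX es => //= x s IHs u uX.
by case/andP=> /(clX _ _ uX) xX; exact: IHs.
Qed.

Lemma tournament_seed (e : rel T) (X : {set T}) (x0 y0 : T) :
  (forall u v, asym (c u) (c v) -> e u v || e v u) ->
  (forall u v, ~~ asym (c u) (c v) -> e u v = e v u) ->
  (forall k l, asym k l -> asym l k) ->
  (forall u v, u \in X -> e u v -> v \in X) ->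
  x0 \in X -> y0 \notin X ->
  exists (p q : K * K -> T) (d : K -> T),
  [/\ forall j, p j \in X,
      [disjoint X & coreach e q],
      reach e q p d \subset X &
      forall u v, u \notin reach e q p d :|: coreach e q ->
        v \notin reach e q p d :|: coreach e q ->
        connect e u v -> connect e v u].
Proof.
move=> tour symE asymC clX x0X y0X.
have clX' := out_closed_connect clX.
have /fin_all_exists[p pP] (j : K * K) : exists p, p \in X /\
    (asym j.1 j.2 -> forall u v, u \in X -> v \in X -> c u = j.1 -> c v = j.2 ->
      connect e p u || connect e p v).
  have [a|na] := boolP (asym j.1 j.2); last by exists x0.
  by have [p pX pP] := dominating_vertex tour asymC x0X a; exists p.
have /fin_all_exists[q qP] (j : K * K) : exists q, q \in ~: X /\
    (asym j.1 j.2 -> forall u v, u \in ~: X -> v \in ~: X ->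
      c u = j.1 -> c v = j.2 -> connect e u q || connect e v q).
  have y0X' : y0 \in ~: X by rewrite in_setC.
  have [a|na] := boolP (asym j.1 j.2); last by exists y0.
  (* [q] is a dominating vertex of the complement for the reversed arcs. *)
  have tour' u v : asym (c u) (c v) -> e v u || e u v.
    by rewrite orbC; exact: tour.
  have [q qX qP] := dominating_vertex (e := fun u v => e v u) tour' asymC y0X' a.
  exists q; split=> // _ u v uX vX us vt.
  have revE x y : connect (fun u v => e v u) x y = connect e y x.
    exact: (connect_rev e x y).
  by rewrite -!revE; exact: qP.
have coX : [disjoint X & coreach e q].
  rewrite disjoints_subset; apply/subsetP=> u uX; rewrite !inE.
  apply/existsP=> -[j uj]; have [] := qP j.
  by rewrite in_setC (clX' _ _ uX uj).
pose W u := (u \notin coreach e q) && ~~ [exists j, connect e (p j) u].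
(* Were both vertices inside [X], [p (s, t)] would reach one of them; were both outside, one of them
   would reach [q (s, t)]. *)
have WX s t u v : asym s t -> W u -> W v -> c u = s -> c v = t ->
    (u \in X) = (v \notin X).
  move=> st /andP[uq /existsPn up] /andP[vq /existsPn vp] us vt.
  have [_ /(_ st) pst] := pP (s, t); have [_ /(_ st) qst] := qP (s, t).
  have [uX|uX] := boolP (u \in X); have [vX|vX] := boolP (v \in X) => //.
    by have := pst u v uX vX us vt; rewrite (negPf (up _)) (negPf (vp _)).
  have := qst u v; rewrite !in_setC => /(_ uX vX us vt) /orP[] uq'.
    by case/negP: uq; rewrite inE; apply/existsP; exists (s, t).
  by case/negP: vq; rewrite inE; apply/existsP; exists (s, t).
(* These are the colours to add: by [WX], the witness [v] outside [X] forces every [W]-vertex of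
   colour [t] into [X]. *)
pose full t := [exists u, [exists v, [&& W u, W v, c u == t, asym t (c v),
  u \in X & v \notin X]]].
have /fin_all_exists[d dP] (t : K) : exists d, if full t then
   (d \notin coreach e q) && (c d == t) else (d \in coreach e q).
  have [/existsP[u /existsP[v]]|_] := boolP (full t).
    by case/and5P=> /andP[Wu _] _ ut _ _; exists u; rewrite Wu.
  (* Any [q] is an inactive representative, since it reaches itself. *)
  exists (q (c x0, c x0)); rewrite inE; apply/existsP; exists (c x0, c x0).
  exact: connect0.
exists p, q, d; split=> //.
- by move=> j; have [] := pP j.
- apply/subsetP=> u; rewrite inE => /existsP[w /andP[/andP[wq sw] wu]].
  apply: (clX' _ _ _ wu); case/orP: sw => [/existsP[j /eqP->]|]; first by have [] := pP j.
  case/existsP=> t; have := dP t; case: ifP; last by move=> _ ->.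
  move=> /existsP[u' /existsP[v']].
  case/and5P=> Wu Wv /eqP ut tv /andP[uX vX] /andP[_ /eqP dt] /andP[_ /eqP wt].
  have wd : c w = t by rewrite wt dt.
  (* A source of full colour is either reached from some [p], hence in the out-closed [X], or a
     [W]-vertex, to which [WX] applies. *)
  have [/existsP[j pw]|wp] := boolP [exists j, connect e (p j) w].
    by apply: (clX' _ _ _ pw); have [] := pP j.
  have Ww : W w by rewrite /W wq.
  by rewrite (WX _ _ _ _ tv Ww Wv wd erefl).
set S := _ :|: _ => u v uS vS.
have SW x : x \notin S -> W x.
  rewrite in_setU negb_or => /andP[xr xq]; rewrite /W xq.
  apply: contra xr => /existsP[j jx]; rewrite inE; apply/existsP; exists (p j).
  rewrite jx /source (disjointFr coX) ?andbT; last by have [] := pP j.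
  by apply/orP; left; apply/existsP; exists j.
(* Of two such vertices, one would be in [X] and the other not; the colour of the former would be
   full, making that vertex a source and so an element of [reach]. *)
have noasym x y : x \notin S -> y \notin S -> ~~ asym (c x) (c y).
  have sub x' y' : x' \in X -> x' \notin S -> y' \notin S ->
     ~~ asym (c x') (c y').
    move=> xX xS yS; apply/negP=> xy.
    have yX : y' \notin X by rewrite -(WX _ _ _ _ xy (SW _ xS) (SW _ yS)).
    have fx : full (c x').
      apply/existsP; exists x'; apply/existsP; exists y'.
      by rewrite !SW // eqxx xy xX.
    have := dP (c x'); rewrite fx => /andP[dq dx].
    have [/andP[xq _]] := SW _ xS.
    case/negP: xS; rewrite in_setU; apply/orP; left; rewrite inE.
    apply/existsP; exists x'; rewrite connect0 andbT /source xq /=.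
    by apply/orP; right; apply/existsP; exists (c x'); rewrite dq eq_sym.
  move=> xS yS; apply/negP=> xy.
  have := WX _ _ _ _ xy (SW _ xS) (SW _ yS) erefl erefl.
  case xX: (x \in X); first by have := sub x y xX xS yS; rewrite xy.
  move/esym/negbFE=> yX; have := sub y x yX yS xS; by rewrite asymC.
(* The path avoids [S]: after entering [reach] it would end there, and meeting [coreach] would put
   its start there. Hence each of its arcs can be reversed. *)
case/connectP=> s es vE; rewrite {v}vE in vS *.
elim: s u uS es vS => [|x s IHs] u uS //= /andP[ux xs] vS.
have xS : x \notin S.
  apply: contra uS => xS; move: xS vS; rewrite !in_setU !negb_or.
  case/orP=> [xr /andP[]|xq _]; last first.
    by rewrite (coreach_closed (connect1 ux) xq) orbT.
  suff -> : last x s \in reach e q p d by [].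
  by apply: reach_closed xr; apply/connectP; exists s.
apply: connect_trans (IHs x xS xs vS) _.
by apply: connect1; rewrite -symE ?noasym.
Qed.

End Tournament.

(** * Derived connectives and parameters under quantifiers *)

Section Formulas.

Variable U : finType.

Section HoldsE.

Variables (G : cgraph U) (n : nat) (v : n.-tuple G).

Lemma holds_not f : holds (FNot f) v = ~~ holds f v.
Proof. by []. Qed.

Lemma holds_and f g : holds (FAnd f g) v = holds f v && holds g v.
Proof. by []. Qed.

Lemma holds_or f g : holds (FOr f g) v = holds f v || holds g v.
Proof. by []. Qed.

Lemma holds_ex f : holds (FEx f) v = [exists x : G, holds f [tuple of x :: v]].
Proof. by []. Qed.

Lemma holds_all f :
  holds (FAll f) v = [forall x : G, holds f [tuple of x :: v]].
Proof. by []. Qed.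

Lemma holds_reach k (A : {set atype U k.+1 * atype U k.+1}) s t a :
  holds (FReach A s t a) v =
  connect (flip_arc A (map_tuple (tnth v) a)) (tnth v s) (tnth v t).
Proof. by []. Qed.

End HoldsE.

Definition falsef n : frl U n := FEx (FNot (FEq U ord0 ord0)).

Lemma holds_falsef (G : cgraph U) n (v : n.-tuple G) : holds (falsef n) v = false.
Proof. by apply/existsP=> -[x] /=; rewrite eqxx. Qed.

Definition disjf n (I : finType) (F : I -> frl U n) : frl U n :=
  foldr (@FOr U n) (falsef n) [seq F i | i <- enum I].

Lemma holds_disjf (G : cgraph U) n (v : n.-tuple G) (I : finType)
    (F : I -> frl U n) :
  holds (disjf F) v = [exists i, holds (F i) v].
Proof.
have -> : [exists i, holds (F i) v] = has (fun i => holds (F i) v) (enum I).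
  by apply/existsP/hasP=> [[i Fi]|[i _ Fi]]; exists i; rewrite ?mem_enum.
rewrite /disjf; elim: (enum I) => [|i s IHs]; first exact: holds_falsef.
by rewrite /= IHs.
Qed.

Definition xorf n (f g : frl U n) : frl U n :=
  FOr (FAnd f (FNot g)) (FAnd (FNot f) g).

Lemma holds_xorf (G : cgraph U) n (v : n.-tuple G) (f g : frl U n) :
  holds (xorf f g) v = holds f v (+) holds g v.
Proof. by rewrite /=; case: (holds f v); case: (holds g v). Qed.

Definition weaken n k (x : k.-tuple 'I_n) : k.-tuple 'I_n.+1 :=
  map_tuple (lift ord0) x.

Lemma weakenE (T : Type) n k (x : k.-tuple 'I_n) (v : n.-tuple T) (t : T) :
  map_tuple (tnth [tuple of t :: v]) (weaken x) = map_tuple (tnth v) x.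
Proof. by apply: eq_from_tnth => i; rewrite !tnth_map tnthS. Qed.

Lemma map_tnth_ord_tuple (T : Type) k (a : k.-tuple T) :
  map_tuple (tnth a) (ord_tuple k) = a.
Proof. by apply: eq_from_tnth => i; rewrite tnth_map tnth_ord_tuple. Qed.

End Formulas.

(** * The seed formulas and their semantics *)

Section SeedFormulas.

Variables (U : finType) (r : nat).

(** Adjacency pattern to the rows [a] (left summand) and the columns [b] (right summand). *)
Definition colour : Type := {ffun 'I_r + 'I_r -> bool}.
HB.instance Definition _ := Finite.on colour.

(** Indices for [a] and [b], for [p] and [q] at each ordered pair of colours, and for [d] at each
    colour; their number depends on [r] only. *)
Definition param : Type :=
  'I_r + 'I_r + (colour * colour) + (colour * colour) + colour.
HB.instance Definition _ := Finite.on param.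

Definition nparam := #|{: param}|.

Definition get (T : Type) (a : nparam.-tuple T) (i : param) : T :=
  tnth a (enum_rank i).

Definition ab_ (T : Type) (a : nparam.-tuple T) (l : 'I_r + 'I_r) : T :=
  get a (inl (inl (inl l))).
Definition p_ (T : Type) (a : nparam.-tuple T) (j : colour * colour) : T :=
  get a (inl (inl (inr j))).
Definition q_ (T : Type) (a : nparam.-tuple T) (j : colour * colour) : T :=
  get a (inl (inr j)).
Definition d_ (T : Type) (a : nparam.-tuple T) (j : colour) : T :=
  get a (inr j).

(* [pinvmx] makes sense for every matrix, so no basis has to be recognised. *)
Definition type_form (t1 t2 : atype U nparam.+1) : 'F_2 :=
  let x := weaken (ord_tuple nparam) in
  ((\row_j (AAdj U ord0 (ab_ x (inr j)) \in t1)%:R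
     *m pinvmx (\matrix_(i, j) (AAdj U (ab_ x (inl i)) (ab_ x (inr j)) \in t1)%:R)
     *m \col_i (AAdj U (ab_ x (inl i)) ord0 \in t2)%:R) 0 0)%R.

Definition flip : {set atype U nparam.+1 * atype U nparam.+1} :=
  [set t | type_form t.1 t.2 == 1%R].

Section Semantics.

Variables (G : cgraph U) (a : nparam.-tuple G).

Definition colour_of (u : G) : colour := [ffun l => adj u (ab_ a l)].

Definition arc : rel G := flip_arc flip a.

(** The second conjunct makes reachability symmetric on the vertices left for the parts; the first
    rejects constant tuples, which thus yield the single-part seed. *)
Definition good : bool :=
  [forall j, p_ a j \notin coreach arc (q_ a)] &&
  [forall u, forall v,
    [|| u \in reach colour_of arc (q_ a) (p_ a) (d_ a) :|: coreach arc (q_ a),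
        v \in reach colour_of arc (q_ a) (p_ a) (d_ a) :|: coreach arc (q_ a)
      | connect arc u v ==> connect arc v u]].

End Semantics.

Definition coreachf n (x : nparam.-tuple 'I_n) (z : 'I_n) : frl U n :=
  disjf (fun j => FReach flip z (q_ x j) x).

(** Equality of colours is expressed as the absence of an [l] where the adjacencies differ. *)
Definition sourcef n (x : nparam.-tuple 'I_n) (w : 'I_n) : frl U n :=
  FAnd (FNot (coreachf x w))
    (FOr (disjf (fun j => FEq U w (p_ x j)))
       (disjf (fun i => FAnd (FNot (coreachf x (d_ x i)))
          (FNot (disjf (fun l =>
             xorf (FAdj U w (ab_ x l)) (FAdj U (d_ x i) (ab_ x l)))))))).

Definition reachf n (x : nparam.-tuple 'I_n) (z : 'I_n) : frl U n :=
  FEx (FAnd (sourcef (weaken x) ord0)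
         (FReach flip ord0 (lift ord0 z) (weaken x))).

Definition goodf n (x : nparam.-tuple 'I_n) : frl U n :=
  FAnd (FNot (disjf (fun j => coreachf x (p_ x j))))
    (FAll (FAll (let x2 := weaken (weaken x) in
       let u : 'I_n.+2 := lift ord0 ord0 in let v : 'I_n.+2 := ord0 in
       FOr (FOr (reachf x2 u) (coreachf x2 u))
         (FOr (FOr (reachf x2 v) (coreachf x2 v))
            (FOr (FNot (FReach flip u v x2)) (FReach flip v u x2)))))).

Section Evaluation.

Variables (G : cgraph U).

Lemma get_map (S T : Type) (f : S -> T) (a : nparam.-tuple S) i :
  get (map_tuple f a) i = f (get a i).
Proof. exact: tnth_map. Qed.

Lemma holds_coreachf n (x : nparam.-tuple 'I_n) (z : 'I_n) (v : n.-tuple G) :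
  let a := map_tuple (tnth v) x in
  holds (coreachf x z) v = (tnth v z \in coreach (arc a) (q_ a)).
Proof.
by rewrite /coreachf /= holds_disjf inE; apply: eq_existsb => j; rewrite /q_ get_map.
Qed.

Lemma holds_sourcef n (x : nparam.-tuple 'I_n) (w : 'I_n) (v : n.-tuple G) :
  let a := map_tuple (tnth v) x in
  holds (sourcef x w) v =
  source (colour_of a) (arc a) (q_ a) (p_ a) (d_ a) (tnth v w).
Proof.
move=> a; rewrite /sourcef /source holds_and holds_not holds_or holds_coreachf
  !holds_disjf; congr (_ && (_ || _)).
  by apply: eq_existsb => j; rewrite /p_ /= get_map.
apply: eq_existsb => i /=; rewrite holds_coreachf holds_disjf /d_ get_map.
congr (_ && _); rewrite -[RHS]negbK; congr (~~ _).
apply/existsP/idP => [[l]|].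
  rewrite holds_xorf /=; apply: contraL => /eqP/ffunP/(_ l).
  by rewrite !ffunE /ab_ !get_map => ->; rewrite addbb.
move=> neq; apply/existsP; apply: contraR neq => /existsPn eqc.
apply/eqP/ffunP=> l; have := eqc l.
by rewrite holds_xorf /= !ffunE /ab_ !get_map; do 2!case: adj.
Qed.

Lemma holds_reachf n (x : nparam.-tuple 'I_n) (z : 'I_n) (v : n.-tuple G) :
  let a := map_tuple (tnth v) x in
  holds (reachf x z) v =
  (tnth v z \in reach (colour_of a) (arc a) (q_ a) (p_ a) (d_ a)).
Proof.
move=> a; rewrite /reachf inE holds_ex; apply: eq_existsb => w.
by rewrite holds_and holds_sourcef holds_reach weakenE tnth0 tnthS.
Qed.

Lemma holds_goodf n (x : nparam.-tuple 'I_n) (v : n.-tuple G) :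
  holds (goodf x) v = good (map_tuple (tnth v) x).
Proof.
rewrite /goodf holds_and holds_not holds_disjf holds_all negb_exists; congr (_ && _).
  apply: eq_forallb => j; rewrite holds_coreachf.
  by rewrite [p_ (map_tuple _ _) _]get_map.
apply: eq_forallb => u; rewrite holds_all; apply: eq_forallb => w.
rewrite !holds_or holds_not !holds_reach.
by rewrite !holds_reachf !holds_coreachf !weakenE !tnthS !tnth0 !in_setU implybE.
Qed.

(** The type of a vertex with the parameters records both its adjacency to [a] and [b] and the
    matrix [M], so the form is a function of two types. *)
Lemma flip_cut_form (a : nparam.-tuple G) (u v : G) :
  ((atp [tuple of u :: a], atp [tuple of v :: a]) \in flip) =
  (cut_form (fun i => ab_ a (inl i)) (fun j => ab_ a (inr j)) u v == 1%R).
Proof.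
rewrite inE /= /type_form /cut_form; set x := weaken _.
have xE (w : G) l : tnth [tuple of w :: a] (ab_ x l) = ab_ a l.
  by rewrite /ab_ [get x _]get_map tnthS /get tnth_ord_tuple.
congr (_ == _).
set P1 := (\row_j _)%R; set M1 := (\matrix_(i, j) _)%R; set Q1 := (\col_i _)%R.
set P2 := (\row_j _)%R; set M2 := (\matrix_(i, j) _)%R; set Q2 := (\col_i _)%R.
have -> : P1 = P2 by apply/rowP=> j; rewrite !mxE inE /= xE tnth0.
have -> : M1 = M2 by apply/matrixP=> i j; rewrite !mxE inE /= !xE.
by have -> : Q1 = Q2 by apply/colP=> j; rewrite !mxE inE /= xE tnth0.
Qed.

Lemma arcE (a : nparam.-tuple G) (u v : G) :
  arc a u v = (u != v) && (((adj u v)%:R)%R !=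
    cut_form (fun i => ab_ a (inl i)) (fun j => ab_ a (inr j)) u v).
Proof.
rewrite /arc /flip_arc flip_cut_form -eq_F2.
by case: adj; case: (_ == 1%R).
Qed.

End Evaluation.

Definition plusf : frl U nparam.+1 :=
  let x := weaken (ord_tuple nparam) in FAnd (goodf x) (reachf x ord0).
Definition minusf : frl U nparam.+1 :=
  let x := weaken (ord_tuple nparam) in FAnd (goodf x) (coreachf x ord0).
(** One direction of reachability suffices, as [good] supplies the other; without [good] all
    vertices are equivalent. *)
Definition samef : frl U nparam.+2 :=
  let x := weaken (weaken (ord_tuple nparam)) in
  FOr (FNot (goodf x)) (FReach flip ord0 (lift ord0 ord0) x).

Lemma holds_plusf (G : cgraph U) (a : nparam.-tuple G) v :
  holds plusf [tuple of v :: a] =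
  good a && (v \in reach (colour_of a) (arc a) (q_ a) (p_ a) (d_ a)).
Proof.
by rewrite /plusf holds_and holds_goodf holds_reachf weakenE map_tnth_ord_tuple tnth0.
Qed.

Lemma holds_minusf (G : cgraph U) (a : nparam.-tuple G) v :
  holds minusf [tuple of v :: a] = good a && (v \in coreach (arc a) (q_ a)).
Proof.
by rewrite /minusf holds_and holds_goodf holds_coreachf weakenE map_tnth_ord_tuple tnth0.
Qed.

Lemma holds_samef (G : cgraph U) (a : nparam.-tuple G) u v :
  holds samef [tuple of u :: [tuple of v :: a]] = (good a ==> connect (arc a) u v).
Proof.
by rewrite /samef holds_or holds_not holds_goodf holds_reach !weakenE
  map_tnth_ord_tuple tnthS !tnth0 implybE.
Qed.

End SeedFormulas.

(** * Spans of seeds and closure under arcs *)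

Section Seeds.

Variables (U : finType) (G : cgraph U).

Lemma Seed_defines k (fp fm : frl U k.+1) (fs : frl U k.+2) (a : k.-tuple G) :
  let S := Seed fp fm fs a in
  [disjoint plus S & minus S] ->
  {in ~: (plus S :|: minus S) & &,
    equivalence_rel (fun u v => holds fs [tuple of u :: [tuple of v :: a]])} ->
  defines_seed fp fm fs a S.
Proof.
move=> S disj eqR; have partS := equivalence_partitionP eqR.
have [/eqP covS trivS _] := and3P partS.
split=> //; first by rewrite /is_seed disj.
move=> u v; rewrite -!in_setC => uW vW.
have pbE := pblock_equivalence_partition eqR uW vW; rewrite -pbE.
split=> [[P PS /andP[uP vP]]|vu]; first by rewrite (def_pblock trivS PS uP).
exists (pblock (parts S) u); first by rewrite pblock_mem ?covS.
by rewrite vu mem_pblock covS uW.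
Qed.

Lemma mem_Span (S : triple G) (X : {set G}) :
  is_seed S -> plus S \subset X -> [disjoint X & minus S] ->
  (forall P u v, P \in parts S -> u \in P -> v \in P -> u \in X -> v \in X) ->
  X \in Span S.
Proof.
case/andP=> _ /and3P[/eqP covS _ _] sub disj closed.
apply/imsetP; exists [set P in parts S | P \subset X].
  by rewrite powersetE; apply/subsetP=> P; rewrite inE => /andP[].
apply/setP=> x; rewrite inE; apply/idP/orP=> [xX|[/(subsetP sub)//|]]; last first.
  by case/bigcupP=> P; rewrite inE => /andP[_ /subsetP sP] /sP.
have [|xp] := boolP (x \in plus S); [by left | right].
have : x \in cover (parts S).
  by rewrite covS !inE negb_or xp (disjointFr disj).
case/bigcupP=> P PS xP; apply/bigcupP; exists P => //; rewrite inE PS /=.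
by apply/subsetP=> y yP; exact: (closed P x y).
Qed.

(** An arc leaving a part can enter neither [minus], which is closed under predecessors, nor another
    part; it can only enter [plus], which is contained in [Y]. *)
Lemma Span_closed (S : triple G) (e : rel G) (Y : {set G}) :
  is_seed S -> Y \in Span S ->
  (forall u v, u \in plus S -> e u v -> v \in plus S) ->
  (forall u v, v \in minus S -> e u v -> u \in minus S) ->
  (forall P u v, P \in parts S -> u \in P -> e u v ->
     v \notin plus S :|: minus S -> v \in P) ->
  forall u v, u \in Y -> e u v -> v \in Y.
Proof.
case/andP=> _ /and3P[/eqP covS _ _] /imsetP[Z]; rewrite powersetE => ZS ->.
move=> plusC minusC partC u v; rewrite !inE => /orP[up|].
  by move/(plusC _ _ up)->.
case/bigcupP=> P PZ uP uv; have PS := subsetP ZS _ PZ.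
have [//|vp] := boolP (v \in plus S); apply/bigcupP; exists P => //.
apply: (partC P u v) => //; rewrite inE negb_or vp.
have : u \in cover (parts S) by apply/bigcupP; exists P.
rewrite covS !inE negb_or => /andP[_]; apply: contra => vm.
exact: minusC uv.
Qed.

End Seeds.

(** * Reachability sets under pointwise equality of the data *)

Section Extensionality.

Variables (T K : finType) (c c' : T -> K) (e e' : rel T) (J J' : finType).
Variables (q q' p p' : J -> T) (d d' : J' -> T).
Hypotheses (cE : c =1 c') (eE : e =2 e').
Hypotheses (qE : q =1 q') (pE : p =1 p') (dE : d =1 d').

Lemma coreach_ext : coreach e q = coreach e' q'.
Proof.
apply/setP=> u; rewrite !inE; apply: eq_existsb => j.
by rewrite qE (eq_connect eE).
Qed.

Lemma reach_ext : reach c e q p d = reach c' e' q' p' d'.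
Proof.
apply/setP=> u; rewrite !inE; apply: eq_existsb => w.
rewrite (eq_connect eE) /source coreach_ext; congr (_ && (_ || _) && _).
  by apply: eq_existsb => j; rewrite pE.
by apply: eq_existsb => j; rewrite dE !cE.
Qed.

End Extensionality.

(** * Uniformity, and both inclusions between spans and low-rank sets *)

Section Main.

Variables (U : finType) (r : nat) (G : cgraph U).
Local Notation nparam := (nparam r).
Local Notation plusf := (plusf U r).
Local Notation minusf := (minusf U r).
Local Notation samef := (samef U r).

Section FixedTuple.

Variable a : nparam.-tuple G.

Let S := Seed plusf minusf samef a.
Let Xp := reach (colour_of a) (arc a) (q_ a) (p_ a) (d_ a).
Let Xm := coreach (arc a) (q_ a).

Lemma plusE v : (v \in plus S) = good a && (v \in Xp).
Proof. by rewrite inE holds_plusf. Qed.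

Lemma minusE v : (v \in minus S) = good a && (v \in Xm).
Proof. by rewrite inE holds_minusf. Qed.

Lemma same_equivalence : {in ~: (plus S :|: minus S) & &,
  equivalence_rel (fun u v => holds samef [tuple of u :: [tuple of v :: a]])}.
Proof.
move=> u v w uW vW wW; rewrite !holds_samef connect0 implybT; split=> //.
have [g|//] := boolP (good a); move=> /= uv; apply/idP/idP; last first.
  exact: connect_trans.
apply: connect_trans; move: uv.
move: uW vW; rewrite !in_setC !in_setU !plusE !minusE g /= -!in_setU => uW vW.
have [_ /forallP/(_ u)/forallP/(_ v)] := andP g.
by rewrite (negPf uW) (negPf vW) => /implyP.
Qed.

Lemma SeedP : defines_seed plusf minusf samef a S.
Proof.
apply: Seed_defines same_equivalence.
rewrite disjoints_subset; apply/subsetP=> v; rewrite in_setC -/S plusE minusE.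
by case/andP=> -> /= /(disjointFr (reach_coreach _ _ _ _ _)) ->.
Qed.

Lemma parts_same P u v : P \in parts S -> u \in P ->
  v \notin plus S :|: minus S -> (v \in P) = (good a ==> connect (arc a) u v).
Proof.
move=> PS uP; rewrite -in_setC => vW; rewrite -holds_samef.
have partS := equivalence_partitionP same_equivalence.
have [/eqP covS trivS _] := and3P partS.
have uW : u \in ~: (plus S :|: minus S) by rewrite -covS; apply/bigcupP; exists P.
by rewrite -(pblock_equivalence_partition same_equivalence uW vW)
  (def_pblock trivS PS uP).
Qed.

Lemma part_outside P u : P \in parts S -> u \in P ->
  u \notin plus S :|: minus S.
Proof.
move=> PS uP; have [/andP[_ /and3P[/eqP covS _ _]] _ _ _] := SeedP.
by rewrite -in_setC -covS; apply/bigcupP; exists P.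
Qed.

(** No arc goes from [plus] into a part, nor from a part to [minus] or another part. So between [u]
    in a part and [v] outside it, adjacency equals the flip in an order decided by [v] alone, and
    only the type of [u] matters. *)
Lemma Seed_uniform : uniform a S.
Proof.
have [/andP[_ /and3P[/eqP covS trivS _]] _ _ _] := SeedP.
have arc_adj u v : u \in cover (parts S) -> v \notin pblock (parts S) u ->
    adj u v = if v \in plus S
      then (atp [tuple of v :: a], atp [tuple of u :: a]) \in flip U r
      else (atp [tuple of u :: a], atp [tuple of v :: a]) \in flip U r.
  move=> uS; have PS := pblock_mem uS; set P := pblock _ u in PS *.
  have uP : u \in P by rewrite mem_pblock.
  move=> vP; have uv : u != v by apply: contraNneq vP => <-.
  have uW := part_outside PS uP.
  have [vp|vp] := boolP (v \in plus S).
    have : ~~ arc a v u.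
      apply: contra uW => vu; rewrite in_setU plusE; move: vp; rewrite plusE.
      by case/andP=> -> /(reach_closed (connect1 vu)) ->.
    rewrite /arc /flip_arc eq_sym uv adj_sym.
    by case: adj; case: (_ \in flip U r).
  suff : ~~ arc a u v.
    by rewrite /arc /flip_arc uv; case: adj; case: (_ \in flip U r).
  apply/negP=> auv; have [vW|] := boolP (v \notin plus S :|: minus S).
    by case/negP: vP; rewrite (parts_same PS uP vW) connect1 ?implybT.
  rewrite negbK in_setU (negPf vp) minusE => /andP[g vm].
  case/negP: uW; rewrite in_setU minusE g.
  by rewrite (coreach_closed (connect1 auv) vm) orbT.
move=> u1 u2 u1S u2S eqt; apply/setP=> v; rewrite !in_setD !in_setU negb_or.
apply: andb_id2l => /andP[v1 v2]; rewrite !inE.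
by rewrite (arc_adj _ _ u1S v1) (arc_adj _ _ u2S v2) eqt.
Qed.

Lemma Span_Seed_low (X : {set G}) : X \in Span S -> X \in LowRank r G.
Proof.
have [seedS _ _ _] := SeedP.
move=> XS; rewrite inE.
apply: (@cutrk_cut_form _ _ _ _ (fun i => ab_ a (inl i)) (fun j => ab_ a (inr j))).
(* A pair of distinct vertices where adjacency differs from the form is an arc, and members of the
   span are closed under out-arcs. *)
move=> u v uX; apply: contraNeq => uv.
have [<- //|neq] := eqVneq u v.
have {neq uv} auv : arc a u v by rewrite arcE neq.
apply: Span_closed XS _ _ _ u v uX auv => // [{}u {}v|{}u {}v|P {}u {}v PS uP].
- rewrite !plusE => /andP[-> uX] /connect1 uv; exact: reach_closed uX.
- rewrite !minusE => /andP[-> vX] /connect1 uv; exact: coreach_closed vX.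
- by move=> /connect1 uv vW; rewrite (parts_same PS uP vW) uv implybT.
Qed.

Lemma mem_Span_Seed (X : {set G}) :
  plus S \subset X -> [disjoint X & minus S] ->
  (forall u v, u \in X -> (good a ==> connect (arc a) u v) -> v \in X) ->
  X \in Span S.
Proof.
have [seedS _ _ _] := SeedP => sub disj closed.
apply: mem_Span => // P u v PS uP vP uX; apply: closed uX _.
by rewrite -(parts_same PS uP) ?(part_outside PS vP).
Qed.

End FixedTuple.

Definition tuple_of_params (f : param r -> G) : nparam.-tuple G :=
  [tuple f (enum_val i) | i < nparam].

Lemma get_tuple_of_params f i : get (tuple_of_params f) i = f i.
Proof. by rewrite /get tnth_mktuple enum_rankK. Qed.

Lemma trivial_mem_Span (x : G) (X : {set G}) : X = set0 \/ X = setT ->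
  exists a : nparam.-tuple G, X \in Span (Seed plusf minusf samef a).
Proof.
(* With all parameters equal, each [p] coincides with a [q] and so lies in [coreach]: [good]
   fails. *)
move=> X01; exists (tuple_of_params (fun=> x)); set a := tuple_of_params _.
have badf : good a = false.
  apply/negP=> /andP[/forallP/(_ ([ffun=> false], [ffun=> false])) /negP[]].
  rewrite inE; apply/existsP; exists ([ffun=> false], [ffun=> false]).
  by rewrite /p_ /q_ !get_tuple_of_params.
apply: mem_Span_Seed.
- by apply/subsetP=> v; rewrite plusE badf.
- by rewrite disjoints_subset; apply/subsetP=> v _; rewrite in_setC minusE badf.
- by move=> u v; case: X01 => ->; rewrite !inE.
Qed.

Lemma low_mem_Span (x y : G) (X : {set G}) :
  x \in X -> y \notin X -> X \in LowRank r G ->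
  exists a : nparam.-tuple G, X \in Span (Seed plusf minusf samef a).
Proof.
rewrite inE => xX yX /(cut_form_exists xX yX)[A [B XE]].
pose ab (l : 'I_r + 'I_r) := match l with inl i => A i | inr j => B j end.
pose c u : colour r := [ffun l => adj u (ab l)].
(* With [M] fixed, the form depends on the two colours only, so its asymmetry is a relation between
   colours. *)
pose form (s t : colour r) : 'F_2 :=
  ((\row_j (s (inr j))%:R *m pinvmx (\matrix_(i, j) (adj (A i) (B j))%:R)
     *m \col_i (t (inl i))%:R) 0 0)%R.
have formE u v : cut_form A B u v = form (c u) (c v).
  rewrite /cut_form /form.
  set P1 := (\row_j _)%R; set Q1 := (\col_i _)%R.
  set P2 := (\row_j _)%R; set Q2 := (\col_i _)%R.
  have -> : P1 = P2 by apply/rowP=> j; rewrite !mxE ffunE.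
  by have -> : Q1 = Q2 by apply/colP=> j; rewrite !mxE ffunE adj_sym.
pose asym s t := form s t != form t s.
pose e : rel G := fun u v => (u != v) && (((adj u v)%:R)%R != cut_form A B u v).
have [||||p [q [d [pX coX reX symW]]]] :=
    @tournament_seed _ _ c asym e X x y _ _ _ _ xX yX.
(* Adjacency is symmetric and cannot agree with two distinct values of the form, so at least one of
   the two arcs is present. *)
- move=> u v; rewrite /asym -!formE /e adj_sym (eq_sym v) => uv.
  have -> : u != v by apply: contraNneq uv => ->.
  by rewrite -negb_and; apply: contraNN uv => /andP[/eqP <- /eqP <-].
- by move=> u v; rewrite negbK -!formE /e adj_sym (eq_sym v) => /eqP ->.
- by move=> s t; rewrite /asym eq_sym.
- move=> u v uX /andP[_]; apply: contraNT => /(XE _ _ uX) ->.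
  by rewrite eqxx.
pose a := tuple_of_params (fun i => match i with
  | inl (inl (inl l)) => ab l
  | inl (inl (inr j)) => p j
  | inl (inr j) => q j
  | inr j => d j end).
have cE : colour_of a =1 c.
  by move=> u; apply/ffunP=> l; rewrite !ffunE /ab_ get_tuple_of_params.
have eE : arc a =2 e.
  have formE' u v : cut_form (fun i => ab_ a (inl i)) (fun j => ab_ a (inr j)) u v =
      cut_form A B u v.
    rewrite /cut_form.
    set P1 := (\row_j _)%R; set M1 := (\matrix_(i, j) _)%R.
    set Q1 := (\col_i _)%R; set P2 := (\row_j _)%R.
    set M2 := (\matrix_(i, j) _)%R; set Q2 := (\col_i _)%R.
    have -> : P1 = P2 by apply/rowP=> j; rewrite !mxE /ab_ get_tuple_of_params.
    have -> : M1 = M2.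
      by apply/matrixP=> i j; rewrite !mxE /ab_ !get_tuple_of_params.
    by have -> : Q1 = Q2 by apply/colP=> j; rewrite !mxE /ab_ get_tuple_of_params.
  by move=> u v; rewrite arcE formE'.
have qE : q_ a =1 q by move=> j; exact: get_tuple_of_params.
have pE : p_ a =1 p by move=> j; exact: get_tuple_of_params.
have dE : d_ a =1 d by move=> j; exact: get_tuple_of_params.
have coE : coreach (arc a) (q_ a) = coreach e q by exact: coreach_ext.
have reE : reach (colour_of a) (arc a) (q_ a) (p_ a) (d_ a) = reach c e q p d.
  exact: reach_ext.
have ga : good a.
  rewrite /good reE coE; apply/andP; split.
    by apply/forallP=> j; rewrite pE (disjointFr coX).
  apply/forallP=> u; apply/forallP=> v; rewrite !(eq_connect eE).
  rewrite -implyNb -implyNb; apply/implyP=> uW; apply/implyP=> vW.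
  by apply/implyP; exact: symW.
exists a; apply: mem_Span_Seed.
- by apply: subset_trans reX; apply/subsetP=> v; rewrite plusE reE => /andP[].
- rewrite disjoints_subset; apply/subsetP=> v vX.
  by rewrite in_setC minusE coE (disjointFr coX) ?andbF.
- move=> u v uX; rewrite ga (eq_connect eE) /=; apply: out_closed_connect uX.
  move=> w z wX /andP[_]; apply: contraNT => /(XE _ _ wX) ->.
  by rewrite eqxx.
Qed.

End Main.

Theorem theorem6p1 (U : finType) (r : nat) :
  exists (k : nat) (fp fm : frl U k.+1) (fs : frl U k.+2),
    (forall (G : cgraph U) (a : k.-tuple G),
       exists2 S : triple G, defines_seed fp fm fs a S & uniform a S) /\
    (forall G : cgraph U, 0 < #|G| ->
       LowRank r G = \bigcup_(a : k.-tuple G) Span (Seed fp fm fs a)).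
Proof.
exists (nparam r), (plusf U r), (minusf U r), (samef U r); split=> G.
  move=> a; exists (Seed (plusf U r) (minusf U r) (samef U r) a).
    exact: SeedP.
  exact: Seed_uniform.
(* The vertex [z] fills the constant tuple for the trivial sets; an empty graph has no tuple of
   positive length, although [set0] has cut-rank 0. *)
case/card_gt0P=> z _; apply/setP=> X; apply/idP/bigcupP=> [lowX|[a _]]; last first.
  exact: Span_Seed_low.
suff [a aX] : exists a : (nparam r).-tuple G,
    X \in Span (Seed (plusf U r) (minusf U r) (samef U r) a) by exists a.
have [->|[x xX]] := set_0Vmem X; first by apply: trivial_mem_Span z _ _; left.
have [XT|[y]] := set_0Vmem (~: X).
  by apply: trivial_mem_Span z _ _; right; rewrite -[X]setCK XT setC0.
by rewrite in_setC => yX; apply: low_mem_Span xX yX lowX.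
Qed.
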